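(* Let $T_{3,d,k}=\mathbb{C}[x_1,x_2,x_3]/(x_1^d,x_2^d,x_3^d)^k$. The algebra $T_{3,d,k}$ fails to have the weak Lefschetz property in each of the following cases, where $j$ and $\ell$ denote integers: (1) $k=2j+1>2$ and $d=(j+2)(2\ell+1)$, where $\ell\ge1$; (2) $k=2j+1>2$, $k\notin\{3,7\}$, and $d=(j+2)(2\ell+1)\pm1$ (either sign), where $\ell\ge1$; (3) $k=2j>2$ and $d\in\{(j+1)(2\ell+1)+\ell,\ (j+1)(2\ell+1)+\ell+1\}$, where $\ell\ge1$.
   Context: A standard graded algebra $A=\bigoplus_i A_i$ over $\mathbb{C}$ has the weak Lefschetz property (WLP) if there exists a linear form $L\in A_1$ such that for every degree $i$ the multiplication map $\times L\colon A_i\to A_{i+1}$ has maximal rank, i.e. is injective or surjective. Here $(x_1^d,x_2^d,x_3^d)^k$ is the $k$-th power of the ideal generated by $x_1^d,x_2^d,x_3^d$. *)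

(* Defs.v *)
From HB Require Import structures.
From mathcomp Require Import all_boot all_order all_algebra.
From mathcomp Require Import generic_quotient ring_quotient.
From mathcomp Require Import boolp classical_sets functions.
From mathcomp Require Import reals complex mpoly.

Set Implicit Arguments.
Unset Strict Implicit.
Unset Printing Implicit Defensive.

Import GRing.Theory.

Local Open Scope ring_scope.
Local Open Scope classical_set_scope.

(* The ideals and quotient rings of ring_quotient.v are restricted to proper
   ideals. The unit ideal is allowed here (it is the 0-th power of any ideal),
   so that quotients are only comPzRingTypes. *)

Section Ideals.
Variable R : comNzRingType.

Record ideal := Ideal {
  ideal_set :> R -> Prop;
  ideal0 : ideal_set 0;
  idealD : forall x y, ideal_set x -> ideal_set y -> ideal_set (x + y);
  idealMl : forall a x, ideal_set x -> ideal_set (a * x)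
}.

Definition ideal_top : ideal :=
  @Ideal setT I (fun _ _ _ _ => I) (fun _ _ _ => I).

Definition ideal_span (G : set R) : set R :=
  [set x | exists s : seq (R * R),
     (forall u, u \in s -> G u.2) /\ x = \sum_(u <- s) u.1 * u.2].

Lemma ideal_span0 (G : set R) : ideal_span G 0.
Proof. by exists [::]; rewrite big_nil. Qed.

Lemma ideal_spanD (G : set R) x y : ideal_span G x -> ideal_span G y -> ideal_span G (x + y).
Proof.
move=> [s [Gs ->]] [t [Gt ->]]; exists (s ++ t); split; last by rewrite big_cat.
by move=> u; rewrite mem_cat => /orP[us|ut]; [exact: Gs|exact: Gt].
Qed.

Lemma ideal_spanMl (G : set R) a x : ideal_span G x -> ideal_span G (a * x).
Proof.
move=> [s [Gs ->]]; exists [seq (a * u.1, u.2) | u <- s]; split.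
  by move=> _ /mapP[u us ->] /=; exact: Gs.
by rewrite big_map mulr_sumr; apply: eq_bigr => u _; rewrite mulrA.
Qed.

Definition ideal_gen (G : set R) : ideal :=
  Ideal (ideal_span0 G) (@ideal_spanD G) (@ideal_spanMl G).

Definition ideal_mul (A B : ideal) : ideal :=
  ideal_gen [set x | exists a b, [/\ A a, B b & x = a * b]].

Definition ideal_exp (A : ideal) (k : nat) : ideal :=
  iter k (ideal_mul A) ideal_top.

Definition ideal_pred (A : ideal) : {pred R} := fun x => `[< A x >].

Lemma ideal_predP (A : ideal) x : reflect (A x) (x \in ideal_pred A).
Proof. exact: asboolP. Qed.

Lemma ideal_zmod_closed (A : ideal) : zmod_closed (ideal_pred A).
Proof.
split; first by apply/ideal_predP; exact: ideal0.
move=> x y /ideal_predP Ax /ideal_predP Ay; apply/ideal_predP.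
by apply: idealD => //; rewrite -mulN1r; exact: idealMl.
Qed.

HB.instance Definition _ (A : ideal) :=
  GRing.isZmodClosed.Build R (ideal_pred A) (ideal_zmod_closed A).

End Ideals.

Section Quotient.
Variables (R : comNzRingType) (A : ideal R).
Local Open Scope quotient_scope.

Definition quot_ring : Type := {ideal_quot (ideal_pred A)}.

HB.instance Definition _ := GRing.Zmodule.on quot_ring.

Definition quot_pi (x : R) : quot_ring := \pi_{ideal_quot (ideal_pred A)} x.
Definition quot_repr (x : quot_ring) : R := repr (x : {ideal_quot (ideal_pred A)}).

Lemma quot_reprK : cancel quot_repr quot_pi.
Proof. exact: reprK. Qed.

Lemma quot_piP x y : quot_pi x = quot_pi y <-> A (x - y).
Proof.
split=> [/eqP|Axy]; last apply/eqP.
  by rewrite -Quotient.idealrBE => /ideal_predP.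
by rewrite -Quotient.idealrBE; exact/ideal_predP.
Qed.

Lemma quot_piD x y : quot_pi (x + y) = quot_pi x + quot_pi y.
Proof. exact: (raddfD (\pi_{ideal_quot (ideal_pred A)})). Qed.

Definition quot_one : quot_ring := quot_pi 1.
Definition quot_mul (x y : quot_ring) : quot_ring :=
  quot_pi (quot_repr x * quot_repr y).

Lemma quot_piM x y : quot_pi (x * y) = quot_mul (quot_pi x) (quot_pi y).
Proof.
have rP z : A (z - quot_repr (quot_pi z)).
  by apply/quot_piP; rewrite quot_reprK.
apply/quot_piP; set x' := quot_repr _; set y' := quot_repr _.
have -> : x * y - x' * y' = y * (x - x') + x' * (y - y').
  by rewrite !mulrBr ![y * _]mulrC addrA subrK.
by apply: idealD; exact/idealMl/rP.
Qed.

Lemma quot_mulA : associative quot_mul.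
Proof.
move=> x y z; rewrite -[x]quot_reprK -[y]quot_reprK -[z]quot_reprK.
by rewrite -!quot_piM mulrA.
Qed.

Lemma quot_mulC : commutative quot_mul.
Proof. by move=> x y; rewrite /quot_mul mulrC. Qed.

Lemma quot_mul1 : left_id quot_one quot_mul.
Proof. by move=> x; rewrite -[x]quot_reprK -quot_piM mul1r. Qed.

Lemma quot_mulDl : left_distributive quot_mul +%R.
Proof.
move=> x y z; rewrite -[x]quot_reprK -[y]quot_reprK -[z]quot_reprK.
by rewrite -!quot_piM -!quot_piD -!quot_piM mulrDl.
Qed.

HB.instance Definition _ := GRing.Zmodule_isComPzRing.Build quot_ring
  quot_mulA quot_mulC quot_mul1 quot_mulDl.

Lemma quot_pi_is_zmod_morphism : zmod_morphism quot_pi.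
Proof. exact: (raddfB (\pi_{ideal_quot (ideal_pred A)})). Qed.

Lemma quot_pi_is_monoid_morphism : monoid_morphism quot_pi.
Proof. by split=> //; exact: quot_piM. Qed.

HB.instance Definition _ := GRing.isZmodMorphism.Build R quot_ring quot_pi
  quot_pi_is_zmod_morphism.
HB.instance Definition _ := GRing.isMonoidMorphism.Build R quot_ring quot_pi
  quot_pi_is_monoid_morphism.

End Quotient.

(* gr i is the homogeneous component of degree i. A general element of gr 1 is
   not required: one Lefschetz element L suffices, the same L for every i. *)
Definition weak_Lefschetz (A : comPzRingType) (gr : nat -> set A) : Prop :=
  exists2 L : A, gr 1%N L &
    forall i : nat, set_inj (gr i) ( *%R L) \/
                    set_surj (gr i) (gr i.+1) ( *%R L).

Definition quot_grading (K : comNzRingType) (n : nat) (A : ideal {mpoly K[n]})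
    (i : nat) : set (quot_ring A) :=
  [set quot_pi A p | p in [set p : {mpoly K[n]} | p \is i.-homog]].

Definition power_ideal (K : comNzRingType) (n d : nat) : ideal {mpoly K[n]} :=
  ideal_gen [set 'X_i ^+ d | i in [set: 'I_n]].

(* R[i] is the field of complex numbers, R being a complete archimedean
   ordered field. *)
Definition T_ideal (R : realType) (n d k : nat) : ideal {mpoly R[i][n]} :=
  ideal_exp (power_ideal R[i] n d) k.

Definition T_algebra (R : realType) (n d k : nat) : comPzRingType :=
  quot_ring (T_ideal R n d k).

Definition T_grading (R : realType) (n d k : nat) :
    nat -> set (T_algebra R n d k) :=
  @quot_grading R[i] n (T_ideal R n d k).

(* Main.v *)
(* Put I = (x1^d, x2^d, x3^d), A = K[x1,x2,x3]/I^k and t = kd + 2l. In every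
   case the multiplication A_(t-1) -> A_t by any linear form L is neither
   injective nor surjective.

   If all coefficients of L are nonzero, rescaling the variables (the ideal is
   monomial) reduces to L = x1 + x2 + x3, and multiplication by L commutes with
   permuting the variables. The invariants of A_(t-1) have larger dimension than
   those of A_t, so L is not injective; the anti-invariants of A_(t-1) have
   smaller dimension than those of A_t, so L is not surjective. These dimensions
   are the numbers N+, resp. N-, of monomials outside I^k with sorted, resp.
   strictly sorted, exponents. By Burnside's formula 6 N+ = N + 3F + 2C and
   6 N- = N - 3F + 2C, where N counts all monomials, F those with two given
   exponents equal, and C <= 1 those with three equal exponents. In degree
   kd + e with e < d, a monomial in I^k is a pair (monomial of degree k in the
   x_i^d, monomial of degree e), so that N and F are explicit. From degree
   t - 1 to t, F drops by k/2 + 1 - [t even], which outweighs the variation of N.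

   If the coefficient of x1 in L vanishes, multiplication by L preserves the
   x1-degree, and there is an explicit kernel element of x1-degree (k-1)d and an
   explicit functional vanishing on the image in x1-degree kd - 1. *)
Require Import Defs.
From mathcomp Require Import all_boot all_order all_algebra.
From mathcomp Require Import zify ring.
From mathcomp Require Import boolp classical_sets functions.
From mathcomp Require Import reals complex mpoly.

Set Implicit Arguments.
Unset Strict Implicit.
Unset Printing Implicit Defensive.

Import GRing.Theory Num.Theory.

(** * Counting monomials up to permutation *)

Section Counting.
Local Open Scope nat_scope.

(** The cutoff [B] keeps the sum finite; for triples of a fixed degree, any [B] above that degree
    loses nothing. *)
Definition sum3 B (f : nat -> nat -> nat -> nat) : nat :=
  \sum_(a < B) \sum_(b < B) \sum_(c < B) f a b c.

Lemma sum_ltn_ord m B : \sum_(b < B) (b < m) = minn B m.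
Proof.
elim: B => [|B IHB]; first by rewrite big_ord0 min0n.
by rewrite big_ord_recr /= IHB; case: (ltnP B m); lia.
Qed.

Lemma sum_eqn_ord x n B : n < B -> \sum_(c < B) (x + c == n) = (x <= n).
Proof.
move=> nB; case: (leqP x n) => xn; last first.
  by rewrite big1 // => i _; apply/eqP; rewrite eqb0; lia.
have nxB : n - x < B by lia.
rewrite (bigD1 (Ordinal nxB)) //= subnKC // eqxx big1 ?addn0 // => i.
by rewrite -val_eqE /= => ine; apply/eqP; rewrite eqb0; lia.
Qed.

Lemma sum_subn_ord m B : m <= B -> (\sum_(a < B) (m - a)) * 2 = m * m.+1.
Proof.
elim: B m => [|B IHB] m mB; first by rewrite big_ord0; lia.
rewrite big_ord_recl mulnDl.
under eq_bigr => i _ do rewrite lift0 subnS -subn1 subnAC subn1.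
by rewrite IHB; [case: m {mB} => [|m] /=; nia|lia].
Qed.

Lemma sum3_simplex n B : n < B ->
  sum3 B (fun a b c => a + b + c == n) * 2 = n.+1 * n.+2.
Proof.
move=> nB; rewrite /sum3.
have -> : \sum_(a < B) \sum_(b < B) \sum_(c < B) (a + b + c == n) =
    \sum_(a < B) (n.+1 - a).
  apply: eq_bigr => a _; under eq_bigr => b _ do rewrite sum_eqn_ord //.
  transitivity (\sum_(b < B) (b < n.+1 - a)); last by rewrite sum_ltn_ord; lia.
  by apply: eq_bigr => b _; congr nat_of_bool; lia.
by rewrite sum_subn_ord.
Qed.

Lemma sum_diag_simplex n B : n < B ->
  \sum_(a < B) \sum_(c < B) (a + a + c == n) = n./2.+1.
Proof.
move=> nB; under eq_bigr => a _ do rewrite sum_eqn_ord //.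
transitivity (\sum_(a < B) (a < n./2.+1)); last by rewrite sum_ltn_ord; lia.
by apply: eq_bigr => a _; congr nat_of_bool; lia.
Qed.

Lemma sum_digits d M (f : nat -> nat) :
  \sum_(a < M * d) f a = \sum_(q < M) \sum_(r < d) f (q * d + r).
Proof.
rewrite -(big_mkord xpredT f); elim: M => [|M IHM].
  by rewrite mul0n big_nil big_ord0.
rewrite big_ord_recr /= -IHM (@big_cat_nat _ _ _ (M * d)) /=; [|lia|lia].
congr (_ + _); rewrite -{1}[M * d]add0n big_addn mulSn addnK big_mkord.
by apply: eq_bigr => i _; rewrite addnC.
Qed.

Lemma sum_mul_sum A B (f g : nat -> nat) :
  \sum_(i < A) \sum_(j < B) f i * g j = (\sum_(i < A) f i) * (\sum_(j < B) g j).
Proof. by rewrite big_distrlr. Qed.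

Lemma eq_sum3 B (f g : nat -> nat -> nat -> nat) :
  (forall a b c, f a b c = g a b c) -> sum3 B f = sum3 B g.
Proof. by move=> fg; do 3!(apply: eq_bigr => ? _); rewrite fg. Qed.

Lemma sum3D B (f g : nat -> nat -> nat -> nat) :
  sum3 B (fun a b c => f a b c + g a b c) = sum3 B f + sum3 B g.
Proof.
rewrite /sum3 -big_split; apply: eq_bigr => a _.
by rewrite -big_split; apply: eq_bigr => b _; rewrite big_split.
Qed.

Lemma sum3_swap12 B (f : nat -> nat -> nat -> nat) :
  sum3 B (fun a b c => f b a c) = sum3 B f.
Proof. by rewrite /sum3 exchange_big. Qed.

Lemma sum3_swap23 B (f : nat -> nat -> nat -> nat) :
  sum3 B (fun a b c => f a c b) = sum3 B f.
Proof. by apply: eq_bigr => a _; rewrite exchange_big. Qed.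

Lemma sum3_rot B (f : nat -> nat -> nat -> nat) :
  sum3 B (fun a b c => f b c a) = sum3 B f.
Proof. by rewrite (sum3_swap12 B (fun a b c => f a c b)) sum3_swap23. Qed.

Lemma sum3_diag B (P : nat -> nat -> nat -> bool) :
  sum3 B (fun a b c => P a b c && (a == b)) = \sum_(a < B) \sum_(c < B) P a a c.
Proof.
apply: eq_bigr => a _; rewrite (bigD1 a) //= [X in _ + X]big1 => [|b ba].
  by rewrite addn0; apply: eq_bigr => c _; rewrite eqxx andbT.
by apply: big1 => c _; rewrite -val_eqE eq_sym in ba; rewrite (negPf ba) andbF.
Qed.

(** * Sorted triples and orbits under permutation of the exponents *)

Section Orbits.
Variables (B : nat) (P : nat -> nat -> nat -> bool).
Hypotheses (P12 : forall a b c, P b a c = P a b c).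
Hypotheses (P23 : forall a b c, P a c b = P a b c).

Let S := sum3 B (fun a b c => [&& P a b c, b < a & c < b]).
Let F := sum3 B (fun a b c => P a b c && (a == b)).

(* Burnside's formula for the sign character of S_3 acting on exponent triples. *)
Lemma sum3_sorted_strict :
  sum3 B P + 2 * sum3 B (fun a b c => [&& P a b c, a == b & b == c]) = 6 * S + 3 * F.
Proof.
pose s a b c : nat := [&& P a b c, b < a & c < b].
pose f a b c : nat := P a b c && (a == b).
rewrite mul2n -addnn -!sum3D.
(* Pointwise on [P]: distinct entries meet one [s], exactly two equal entries meet one [f], three
   equal entries meet three [f]; this matches [1 + 2 [a = b = c]]. *)
transitivity (sum3 B (fun a b c => s a b c + s a c b + s b a c + s b c a +
  s c a b + s c b a + (f a b c + f b c a + f a c b))).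
  apply: eq_sum3 => a b c; rewrite /s /f.
  rewrite (P12 b c a) (P12 a c b) (P23 b a c) (P23 a b c) (P12 a b c).
  case: (P a b c); rewrite ?andFb //=.
  by case: (ltngtP a b) => ?; case: (ltngtP b c) => ?; case: (ltngtP a c) => ? //=; lia.
rewrite !sum3D (sum3_swap12 B s) (sum3_swap23 B s) (sum3_rot B s).
rewrite (sum3_rot B (fun a b c => s b c a)) (sum3_rot B s).
rewrite (sum3_swap12 B (fun a b c => s c a b)) (sum3_swap23 B (fun a b c => s b a c)).
rewrite (sum3_swap12 B s) (sum3_rot B f) (sum3_swap23 B f) /S /F -/s -/f.
by rewrite -[sum3 B s]/S; lia.
Qed.

(** A weakly but not strictly sorted triple has [a = b >= c] or [a > b = c]. Rotating the second
    family to [a = b < c] turns the two into the two halves of [F]. *)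
Lemma sum3_sorted : sum3 B (fun a b c => [&& P a b c, b <= a & c <= b]) = S + F.
Proof.
pose g a b c : nat := [&& P a b c, a == b & b < c].
pose h a b c : nat := [&& P a b c, a == b & c <= b].
have -> : F = sum3 B g + sum3 B h.
  rewrite -sum3D; apply: eq_sum3 => a b c; rewrite /g /h.
  by case: (P a b c) => //=; case: (a == b) => //=; case: (ltnP b c).
rewrite -(sum3_rot B g) /S -!sum3D; apply: eq_sum3 => a b c; rewrite /g /h.
rewrite (P23 b a c) (P12 a b c); case: (P a b c) => //=.
by case: (ltngtP a b) => ?; case: (ltngtP b c) => ? //=; lia.
Qed.

End Orbits.

(** * Monomials inside and outside the ideal, through quotients and remainders modulo d *)

Section Digits.
Variables (d k e : nat).
Hypothesis ltd : e < d.

Let t := k * d + e.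

(** In use [s'] is a sum of remainders and may exceed [d], so uniqueness of Euclidean division does
    not apply; but [s > k] would give [s * d > t], because [e < d]. *)
Lemma split_digits (s s' : nat) :
  (s * d + s' == t) && (k <= s) = (s == k) && (s' == e).
Proof.
rewrite /t; apply/andP/andP => [[/eqP E ks]|[/eqP-> /eqP->]] //.
have sk : s = k by nia.
by rewrite sk in E *; split => //; apply/eqP; lia.
Qed.

(** With each exponent written as [q * d + r], [split_digits] separates the condition into one on
    quotients and one on remainders, and the sum factors. The cutoff [k.+1 * d] makes quotients
    range below [k.+1] and remainders below [d]. *)
Lemma sum3_ideal :
  sum3 (k.+1 * d) (fun a b c => (a + b + c == t) && (k <= a %/ d + b %/ d + c %/ d))
  = sum3 k.+1 (fun a b c => a + b + c == k) * sum3 d (fun a b c => a + b + c == e).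
Proof.
pose f a b c : nat := (a + b + c == t) && (k <= a %/ d + b %/ d + c %/ d).
rewrite /sum3 (sum_digits _ _ (fun a => \sum_(b < _) \sum_(c < _) f a b c)).
rewrite -(sum_mul_sum _ _ (fun q => \sum_(b < _) \sum_(c < _) (q + b + c == k))
  (fun r => \sum_(b < _) \sum_(c < _) (r + b + c == e))).
apply: eq_bigr => q1 _; apply: eq_bigr => r1 _.
rewrite (sum_digits _ _ (fun b => \sum_(c < _) f _ b c)).
rewrite -(sum_mul_sum _ _ (fun q => \sum_(c < _) (q1 + q + c == k))
  (fun r => \sum_(c < _) (r1 + r + c == e))).
apply: eq_bigr => q2 _; apply: eq_bigr => r2 _.
rewrite (sum_digits _ _ (fun c => f _ _ c)).
rewrite -(sum_mul_sum _ _ (fun q => (q1 + q2 + q == k))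
  (fun r => (r1 + r2 + r == e))).
apply: eq_bigr => q3 _; apply: eq_bigr => r3 _.
rewrite /f mulnb -split_digits !divnMDl ?(leq_trans _ ltd) // !divn_small // !addn0.
by congr (nat_of_bool ((_ == _) && _)); lia.
Qed.

Lemma diag_ideal :
  \sum_(a < k.+1 * d) \sum_(c < k.+1 * d)
    ((a + a + c == t) && (k <= a %/ d + a %/ d + c %/ d)) = k./2.+1 * e./2.+1.
Proof.
pose f a c : nat := (a + a + c == t) && (k <= a %/ d + a %/ d + c %/ d).
rewrite -(@sum_diag_simplex k k.+1) // -(@sum_diag_simplex e d) //.
rewrite (sum_digits _ _ (fun a => \sum_(c < _) f a c)).
rewrite -(sum_mul_sum _ _ (fun q => \sum_(c < _) (q + q + c == k))
  (fun r => \sum_(c < _) (r + r + c == e))).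
apply: eq_bigr => q1 _; apply: eq_bigr => r1 _.
rewrite (sum_digits _ _ (fun c => f _ c)).
rewrite -(sum_mul_sum _ _ (fun q => (q1 + q1 + q == k))
  (fun r => (r1 + r1 + r == e))).
apply: eq_bigr => q3 _; apply: eq_bigr => r3 _.
rewrite /f mulnb -split_digits !divnMDl ?(leq_trans _ ltd) // !divn_small // !addn0.
by congr (nat_of_bool ((_ == _) && _)); lia.
Qed.

End Digits.

(* (a, b, c) is the exponent triple of a monomial of degree t which is not in
   (x1^d, x2^d, x3^d)^k. *)
Definition outside d k t a b c :=
  (a + b + c == t) && (a %/ d + b %/ d + c %/ d < k).

Lemma outside12 d k t a b c : outside d k t b a c = outside d k t a b c.
Proof. by rewrite /outside [b + a]addnC [b %/ d + _]addnC. Qed.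

Lemma outside23 d k t a b c : outside d k t a c b = outside d k t a b c.
Proof. by rewrite /outside addnAC [a %/ d + _ + _]addnAC. Qed.

(** All monomials of degree [t] less those of [sum3_ideal]; the factor 4 clears the denominators of
    the binomial coefficients. *)
Lemma sum3_outside d k e : e < d ->
  4 * sum3 (k.+1 * d) (outside d k (k * d + e)) + k.+1 * k.+2 * (e.+1 * e.+2)
  = 2 * ((k * d + e).+1 * (k * d + e).+2).
Proof.
move=> ed; set t := k * d + e; set B := k.+1 * d.
have tB : t < B by rewrite /t /B; lia.
have := sum3_simplex tB; rewrite -(sum3_simplex ed) -(sum3_simplex (ltnSn k)).
have := sum3_ideal k ed; rewrite -/t -/B => Q <-.
suff -> : sum3 B (fun a b c => a + b + c == t) = sum3 B (outside d k t) +
  sum3 k.+1 (fun a b c => a + b + c == k) * sum3 d (fun a b c => a + b + c == e) by lia.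
rewrite -Q -sum3D; apply: eq_sum3 => a b c; rewrite /outside.
by case: eqP => //= _; case: ltnP.
Qed.

Lemma diag_outside d k e : e < d ->
  sum3 (k.+1 * d) (fun a b c => outside d k (k * d + e) a b c && (a == b))
    + k./2.+1 * e./2.+1 = (k * d + e)./2.+1.
Proof.
move=> ed; set t := k * d + e; set B := k.+1 * d.
have tB : t < B by rewrite /t /B; lia.
rewrite sum3_diag -(diag_ideal k ed) -(sum_diag_simplex tB) -big_split.
apply: eq_bigr => a _; rewrite -big_split; apply: eq_bigr => c _; rewrite /outside /=.
by case: eqP => //= _; case: ltnP.
Qed.

(** The only candidate is [a = b = c = t %/ 3]. *)
Lemma small_diag_outside d k t B :
  sum3 B (fun a b c => [&& outside d k t a b c, a == b & b == c]) <= 1.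
Proof.
rewrite (@leq_trans (sum3 B
  (fun a b c => (a + b + c == t) && (b == c) && (a == b)))) //.
  do 3!(apply: leq_sum => ? _); rewrite /outside.
  by case: (_ + _ == t); case: (_ < k); case: (_ == _); case: (_ == _).
have /= -> := sum3_diag B (fun a b c => (a + b + c == t) && (b == c)).
rewrite (@leq_trans (\sum_(a < B) (a == t %/ 3 :> nat))) //.
  apply: leq_sum => a _.
  rewrite (@leq_trans (\sum_(c < B) ((a == c) && (a == t %/ 3 :> nat)))) //.
    by apply: leq_sum => c _; rewrite -val_eqE /=; case: eqP; lia.
  by rewrite (bigD1 a) //= eqxx big1 ?addn0 // => c ca; rewrite eq_sym (negPf ca).
case: (ltnP (t %/ 3) B) => tB; last first.
  by rewrite big1 // => a _; apply/eqP; rewrite eqb0; have := ltn_ord a; lia.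
rewrite (bigD1 (Ordinal tB)) //= eqxx big1 // => a; rewrite -val_eqE /= => /negPf ->.
by [].
Qed.

(* With D = k d - k (k + 3) (2 l + 1) / 2 the difference of the numbers of
   triples outside the ideal in degrees t and t - 1, the last two hypotheses say
   |D| + 2 < 3 (k/2 + 1 - [t even]). *)
Lemma orbit_counts d k l (B := k.+1 * d) (t := k * d + 2 * l) :
    0 < l -> 2 * l < d ->
    k * (2 * d) + 4 + 6 * ~~ odd t < k * (k + 3) * (2 * l + 1) + 6 * k./2.+1 ->
    k * (k + 3) * (2 * l + 1) + 4 + 6 * ~~ odd t < k * (2 * d) + 6 * k./2.+1 ->
  sum3 B (fun a b c => [&& outside d k t a b c, b <= a & c <= b])
    < sum3 B (fun a b c => [&& outside d k t.-1 a b c, b <= a & c <= b]) /\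
  sum3 B (fun a b c => [&& outside d k t.-1 a b c, b < a & c < b])
    < sum3 B (fun a b c => [&& outside d k t a b c, b < a & c < b]).
Proof.
move=> l0 ld h1 h2; have ld' : (2 * l).-1 < d by lia.
have t1 : t.-1 = k * d + (2 * l).-1 by rewrite /t; lia.
have o := outside12; have o' := outside23.
rewrite !sum3_sorted //.
have := sum3_sorted_strict B (o d k t) (o' d k t).
have := sum3_sorted_strict B (o d k t.-1) (o' d k t.-1).
have := small_diag_outside d k t B; have := small_diag_outside d k t.-1 B.
have := sum3_outside k ld; have := sum3_outside k ld'.
have := diag_outside k ld; have := diag_outside k ld'.
rewrite -/t -/B -t1.
move: (sum3 B (outside d k t)) (sum3 B (outside d k t.-1)) => N N'.
move: (sum3 _ _) (sum3 _ _) (sum3 _ _) (sum3 _ _) (sum3 _ _) (sum3 _ _).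
move=> S S' C C' F F'.
move=> e1 e2 e3 e4 c1 c2 e5 e6.
(* From remainder [2 l - 1] to [2 l] the factor [e./2.+1] rises from [l] to [l + 1]: the ideal gains
   [k./2.+1] diagonal triples, while the whole degree gains only [[t even]]. *)
have l1 : (2 * l).-1./2.+1 = l by lia.
have l2 : (2 * l)./2 = l by lia.
rewrite l1 in e1; rewrite l2 in e2.
have t0 : 0 < t by rewrite /t; lia.
have et : t./2.+1 = t.-1./2.+1 + ~~ odd t.
  by rewrite -{1 3}(prednK t0) /= negbK uphalf_half addSn addnC.
have eF : F + k./2.+1 = F' + ~~ odd t by rewrite et -e1 mulnS in e2; lia.
(* [N - N'] is [t + 1] less [(k + 1)(k + 2)(2 l + 1) / 2]. As [(k + 1)(k + 2) = k (k + 3) + 2] and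
   [t + 1 = k d + (2 l + 1)], the two terms [2 l + 1] cancel. *)
have eN : 2 * N + k * (k + 3) * (2 * l + 1) = 2 * N' + k * (2 * d).
  by rewrite !prednK ?muln_gt0 // in e3; rewrite /t in e3 e4; clear -e3 e4; lia.
move: h1 h2 eF eN; move: (nat_of_bool _) (k * _) (k * _ * _) => p x y h1 h2 eF eN.
by clear -h1 h2 c1 c2 e5 e6 eF eN; lia.
Qed.

End Counting.

Local Open Scope ring_scope.

(** * Symmetric kernel elements and skew-symmetric functionals *)

Section Kernel.
Variables (K : fieldType) (T : eqType) (Phi : (T -> K) -> T -> K).
Hypothesis Phi_linear : forall a f g e,
  Phi (fun x => a * f x + g x) e = a * Phi f e + Phi g e.

Lemma Phi_sum (I : Type) (r : seq I) (c : I -> K) (f : I -> T -> K) e :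
  Phi (fun x => \sum_(i <- r) c i * f i x) e = \sum_(i <- r) c i * Phi (f i) e.
Proof.
elim: r => [|i r IHr].
  rewrite big_nil; under eq_fun => x do rewrite big_nil.
  have := Phi_linear 1 (fun=> 0) (fun=> 0) e.
  under eq_fun => x do rewrite mulr0 addr0.
  by rewrite mul1r -{1}[Phi _ e]addr0 => /addrI.
by rewrite big_cons -IHr -Phi_linear; under eq_fun => x do rewrite big_cons.
Qed.

(** Rank-nullity for the matrix of values at [E] of [Phi] on the indicator functions of [U]. *)
Lemma exists_kernel (U E : seq T) : uniq U -> (size E < size U)%N ->
  exists w : T -> K, [/\ exists2 x, x \in U & w x != 0,
    forall x, x \notin U -> w x = 0 & forall e, e \in E -> Phi w e = 0].
Proof.
move=> uU sEU; pose U' i := tnth (in_tuple U) i; pose E' j := tnth (in_tuple E) j.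
pose A := \matrix_(i < size U, j < size E) Phi (fun x => (x == U' i)%:R) (E' j).
have /rowV0Pn[v /sub_kermxP vA v0] : kermx A != 0.
  rewrite -mxrank_eq0 mxrank_ker subn_eq0 -ltnNge.
  exact: leq_ltn_trans (rank_leq_col _) sEU.
pose w x := \sum_(i < size U) v 0 i * (x == U' i)%:R.
have wU i : w (U' i) = v 0 i.
  rewrite /w (bigD1 i) //= eqxx mulr1 big1 ?addr0 // => j ji.
  rewrite /U' !(tnth_nth (U' i)) nth_uniq //= (_ : (_ == _ :> nat) = false) ?mulr0 //.
  by rewrite eq_sym; apply: negPf.
exists w; split.
- have [i vi] : exists i, v 0 i != 0.
    by apply/existsP; apply: contraNT v0 => /existsPn v0; apply/eqP/rowP => i;
       rewrite mxE; apply/eqP; have := v0 i; rewrite negbK.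
  by exists (U' i); rewrite ?wU // mem_tnth.
- move=> x xU; apply: big1 => i _; case: eqP => [xi|]; last by rewrite mulr0.
  by move: xU; rewrite xi mem_tnth.
- move=> e /seq_tnthP[j ->]; rewrite /w Phi_sum.
  move/rowP: vA => /(_ j); rewrite !mxE => vA; rewrite -[RHS]vA.
  by apply: eq_bigr => i _; rewrite mxE.
Qed.

End Kernel.

Definition triples B (P : nat -> nat -> nat -> bool) : seq (nat * nat * nat) :=
  [seq x <- [seq (x, c) | x <- [seq (a, b) | a <- iota 0 B, b <- iota 0 B],
                          c <- iota 0 B]
   | P x.1.1 x.1.2 x.2].

Lemma triples_uniq B P : uniq (triples B P).
Proof.
apply/filter_uniq/allpairs_uniq; rewrite ?iota_uniq //; last by move=> [? ?] [? ?].
by apply/allpairs_uniq; rewrite ?iota_uniq // => -[? ?] [? ?].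
Qed.

Lemma mem_triples B P a b c :
  ((a, b, c) \in triples B P) = [&& P a b c, a < B, b < B & c < B]%N.
Proof.
rewrite mem_filter /=; congr andb.
apply/allpairsP/and3P => /= [[[x c'] /= [xB cB [abx ccx]]]|[aB bB cB]].
  move: xB; rewrite -abx => /allpairsP[[a' b'] /= [aB bB [-> ->]]].
  by move: aB bB cB; rewrite -ccx !mem_iota.
exists ((a, b), c); rewrite mem_iota; split=> //; apply/allpairsP.
by exists (a, b); rewrite !mem_iota.
Qed.

Lemma size_triples B P : size (triples B P) = sum3 B P.
Proof.
rewrite -sum1_size big_filter big_mkcond /= !big_allpairs /= /sum3.
have E n : iota 0 n = index_iota 0 n by rewrite /index_iota subn0.
rewrite E big_mkord; apply: eq_bigr => a _.
rewrite big_mkord; apply: eq_bigr => b _.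
by rewrite big_mkord; apply: eq_bigr => c _; case: (P _ _ _).
Qed.

(** [exists_kernel] supplies equations at sorted triples only; the two adjacent transpositions
    generate all permutations and carry them to every triple. *)
Lemma sort3_ind (Q : nat -> nat -> nat -> Prop) :
  (forall a b c, Q a b c -> Q b a c) -> (forall a b c, Q a b c -> Q a c b) ->
  (forall a b c, b <= a -> c <= b -> Q a b c)%N -> forall a b c, Q a b c.
Proof.
move=> Q12 Q23 Qs a b c.
wlog ab : a b c / (b <= a)%N.
  by move=> W; case/orP: (leq_total b a) => ?; [|apply: Q12]; apply: W.
wlog bc : a b c ab / (c <= b)%N; last exact: Qs.
move=> W; case/orP: (leq_total c b) => cb; first exact: W.
case/orP: (leq_total c a) => ca; first by apply: Q23; apply: W.
by apply: Q23; apply: Q12; apply: W.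
Qed.

Section Invariants.
Variables (K : numFieldType) (B d k t : nat).
Hypothesis tB : (t < B)%N.
Implicit Types (u : nat -> nat -> nat -> K) (w : nat * nat * nat -> K).

(* [lower] is multiplication by x1 + x2 + x3 on coefficient functions, [raise]
   its transpose. *)
Definition lower u a b c : K :=
  (if a is a'.+1 then u a' b c else 0) + (if b is b'.+1 then u a b' c else 0)
  + (if c is c'.+1 then u a b c' else 0).

Definition raise u a b c : K := u a.+1 b c + u a b.+1 c + u a b c.+1.

(** Not normalised: for [w] supported on sorted triples, repeated entries produce a factor 2 or 6,
    harmless in characteristic 0. *)
Definition symm w a b c : K :=
  w (a, b, c) + w (a, c, b) + w (b, a, c) + w (b, c, a) + w (c, a, b) + w (c, b, a).

Definition skew w a b c : K :=
  w (a, b, c) - w (a, c, b) - w (b, a, c) + w (b, c, a) + w (c, a, b) - w (c, b, a).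

Lemma lower_symm12 w a b c : lower (symm w) b a c = lower (symm w) a b c.
Proof. by rewrite /lower /symm; case: a b c => [|a] [|b] [|c]; ring. Qed.

Lemma lower_symm23 w a b c : lower (symm w) a c b = lower (symm w) a b c.
Proof. by rewrite /lower /symm; case: a b c => [|a] [|b] [|c]; ring. Qed.

Lemma raise_skew12 w a b c : raise (skew w) b a c = - raise (skew w) a b c.
Proof. by rewrite /raise /skew; ring. Qed.

Lemma raise_skew23 w a b c : raise (skew w) a c b = - raise (skew w) a b c.
Proof. by rewrite /raise /skew; ring. Qed.

Lemma outside_orbit s w :
  (forall a b c, w (a, b, c) != 0 -> outside d k s a b c) ->
  forall a b c, ~~ outside d k s a b c ->
  [/\ w (a, b, c) = 0, w (a, c, b) = 0 & w (b, a, c) = 0] /\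
  [/\ w (b, c, a) = 0, w (c, a, b) = 0 & w (c, b, a) = 0].
Proof.
move=> out a b c nout.
have z x y z : outside d k s x y z = outside d k s a b c -> w (x, y, z) = 0.
  by move=> e; apply: contraNeq nout => /out; rewrite e.
split; split; apply: z => //; first exact: outside23.
- exact: outside12.
- by rewrite outside23 outside12.
- by rewrite outside12 outside23.
- by rewrite outside12 outside23 outside12.
Qed.

(** The unknowns are values on sorted triples of degree [t - 1], the equations the vanishing of
    [lower (symm w)] at sorted triples of degree [t]. *)
Lemma exists_symm_lower :
  (sum3 B (fun a b c => [&& outside d k t a b c, b <= a & c <= b])
    < sum3 B (fun a b c => [&& outside d k t.-1 a b c, b <= a & c <= b]))%N ->
  exists u, [/\ exists a b c, u a b c != 0,
    forall a b c, u a b c != 0 -> outside d k t.-1 a b c &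
    forall a b c, outside d k t a b c -> lower u a b c = 0].
Proof.
pose P a b c := [&& outside d k t a b c, b <= a & c <= b]%N.
pose P' a b c := [&& outside d k t.-1 a b c, b <= a & c <= b]%N.
rewrite -(size_triples B P) -(size_triples B P') => lt_size.
pose Phi w (x : nat * nat * nat) := lower (symm w) x.1.1 x.1.2 x.2.
have [|w [[[[a b] c] abc w0] wU wE]] :=
  @exists_kernel K _ Phi _ _ _ (triples_uniq B P') lt_size.
  move=> x f g [[a b] c]; rewrite /Phi /lower /symm /=.
  by case: a b c => [|a] [|b] [|c]; ring.
have wP' x y z : w (x, y, z) != 0 -> P' x y z.
  by apply: contra_neqT => nP; apply: wU; rewrite mem_triples (negPf nP).
have out x y z : w (x, y, z) != 0 -> outside d k t.-1 x y z.
  by move/wP'/and3P => [].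
have wn x y z : ~~ ((y <= x) && (z <= y))%N -> w (x, y, z) = 0.
  by move=> n; apply: contraNeq n => /wP'/and3P[_ -> ->].
exists (symm w); split.
(* At a sorted triple only the permutations fixing it meet the support of [w], so [symm w] is 6, 2
   or 1 times [w]. *)
- exists a, b, c; move/wP'/and3P: (w0) => [_ ba cb]; rewrite /symm.
  have [eab|ab] := eqVneq a b.
    subst b; have [eac|ac] := eqVneq a c.
      subst c; have -> : w (a, a, a) + w (a, a, a) + w (a, a, a) + w (a, a, a) +
        w (a, a, a) + w (a, a, a) = w (a, a, a) *+ 6 by ring.
      by rewrite mulrn_eq0.
    rewrite (wn a c a) ?(wn c a a) ?addr0 ?add0r; [|lia|lia].
    by rewrite -mulr2n mulrn_eq0.
  rewrite (wn b a c) ?(wn b c a) ?(wn c a b) ?(wn c b a) ?addr0; [|lia|lia|lia|lia].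
  have [ebc|bc] := eqVneq b c; first by subst c; rewrite -mulr2n mulrn_eq0.
  by rewrite (wn a c b) ?addr0 //; lia.
- move=> a' b' c'; apply: contra_neqT => /(outside_orbit out).
  by rewrite /symm => -[[-> -> ->] [-> -> ->]]; rewrite !addr0.
- apply: sort3_ind => [a' b' c' H|a' b' c' H|a' b' c' ba cb].
  + by rewrite outside12 lower_symm12.
  + by rewrite outside23 lower_symm23.
  + move=> o; apply: (wE (a', b', c')); rewrite mem_triples /P o ba cb /=.
    by case/andP: o => /eqP o _; apply/and3P; split; lia.
Qed.

(** Here the unknowns live on strictly sorted triples of degree [t] and the equations in degree
    [t - 1]; at all other triples the equation holds automatically. *)
Lemma exists_skew_raise :
  (sum3 B (fun a b c => [&& outside d k t.-1 a b c, b < a & c < b])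
    < sum3 B (fun a b c => [&& outside d k t a b c, b < a & c < b]))%N ->
  exists v, [/\ exists a b c, v a b c != 0,
    forall a b c, v a b c != 0 -> outside d k t a b c &
    forall a b c, raise v a b c = 0].
Proof.
pose P a b c := [&& outside d k t a b c, b < a & c < b]%N.
pose P' a b c := [&& outside d k t.-1 a b c, b < a & c < b]%N.
rewrite -(size_triples B P) -(size_triples B P') => lt_size.
pose Phi w (x : nat * nat * nat) := raise (skew w) x.1.1 x.1.2 x.2.
have [|w [[[[a b] c] abc w0] wU wE]] :=
  @exists_kernel K _ Phi _ _ _ (triples_uniq B P) lt_size.
  by move=> x f g [[a b] c]; rewrite /Phi /raise /skew /=; ring.
have wP x y z : w (x, y, z) != 0 -> P x y z.
  by apply: contra_neqT => nP; apply: wU; rewrite mem_triples (negPf nP).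
have out x y z : w (x, y, z) != 0 -> outside d k t x y z.
  by move/wP/and3P => [].
have wn x y z : ~~ ((y < x) && (z < y))%N -> w (x, y, z) = 0.
  by move=> n; apply: contraNeq n => /wP/and3P[_ -> ->].
have skew_out a' b' c' : ~~ outside d k t a' b' c' -> skew w a' b' c' = 0.
  move=> /(outside_orbit out).
  by rewrite /skew => -[[-> -> ->] [-> -> ->]]; rewrite !subr0 !addr0.
exists (skew w); split.
- exists a, b, c; move/wP/and3P: (w0) => [_ ba cb]; rewrite /skew.
  by rewrite (wn a c b) ?(wn b a c) ?(wn b c a) ?(wn c a b) ?(wn c b a)
    ?addr0 ?subr0 //; lia.
- by move=> a' b' c'; apply: contra_neqT => /skew_out.
- apply: sort3_ind => [a' b' c' H|a' b' c' H|a' b' c' ba cb].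
  + by rewrite raise_skew12 H oppr0.
  + by rewrite raise_skew23 H oppr0.
  (* Two equal exponents: the terms of [raise] cancel or vanish by skew-symmetry. *)
  + have [ba'|ba'] := boolP (b' < a')%N; last first.
      have -> : a' = b' by lia.
      by rewrite /raise /skew; ring.
    have [cb'|cb'] := boolP (c' < b')%N; last first.
      have -> : b' = c' by lia.
      by rewrite /raise /skew; ring.
    have [o|no] := boolP (outside d k t.-1 a' b' c').
      apply: (wE (a', b', c')); rewrite mem_triples /P' o ba' cb' /=.
      by case/andP: o => /eqP o _; apply/and3P; split; lia.
    (* Divisors of a monomial outside the ideal are outside it too, so no value of [skew w] entering
       this equation lies in its support. *)
    have nout x y z : (a' <= x -> b' <= y -> c' <= z ->
        x + y + z = (a' + b' + c').+1 -> ~~ outside d k t x y z)%N.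
      move=> ax b_y cz E; apply: contra no => /andP[/eqP Et]; rewrite /outside => lt_k.
      apply/andP; split; first by lia.
      apply: leq_ltn_trans lt_k.
      by rewrite !leq_add ?leq_div2r.
    by rewrite /raise !skew_out ?addr0 //; apply: nout; lia.
Qed.

End Invariants.

(** * Multiplication by a linear form modulo a power of (x_1^d, ..., x_n^d) *)

Section PowerIdeal.
Variables (K : comNzRingType) (n d : nat).
Hypothesis d_gt0 : (0 < d)%N.
Implicit Types (m : 'X_{1..n}) (p q : {mpoly K[n]}).

(** The largest [k] such that the monomial lies in the [k]-th power of [(x_1^d, ..., x_n^d)]. *)
Definition digit_sum m : nat := \sum_i (m i %/ d)%N.

Lemma digit_sumD m1 m2 : (digit_sum m1 + digit_sum m2 <= digit_sum (m1 + m2)%MM)%N.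
Proof.
rewrite /digit_sum -big_split; apply: leq_sum => i _ /=.
by rewrite mnmDE divnD // leq_addr.
Qed.

Lemma digit_sum_Udn i : digit_sum (U_(i) *+ d)%MM = 1%N.
Proof.
rewrite /digit_sum (bigD1 i) //= mulmnE mnm1E eqxx mul1n divnn d_gt0 big1 // => j ji.
by rewrite mulmnE mnm1E eq_sym (negPf ji) mul0n div0n.
Qed.

(** [digit_sum] is superadditive and equals 1 on each [x_i^d], so every further factor from the
    ideal raises it by at least 1. *)
Lemma power_ideal_exp_coeff k p m :
  ideal_exp (power_ideal K n d) k p -> p@_m != 0 -> (k <= digit_sum m)%N.
Proof.
have msupp_span (G : set {mpoly K[n]}) r q m' :
    (forall g, G g -> forall m'', g@_m'' != 0 -> (r <= digit_sum m'')%N) ->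
    ideal_gen G q -> q@_m' != 0 -> (r <= digit_sum m')%N.
  move=> Gr [s [Gs ->]] {q}; elim: s Gs => [|x s IHs] Gs.
    by rewrite big_nil mcoeff0 eqxx.
  rewrite big_cons mcoeffD; have [x0|] := eqVneq ((x.1 * x.2)@_m') 0.
    by rewrite x0 add0r; apply: IHs => u us; apply: Gs; rewrite inE us orbT.
  rewrite -mcoeff_msupp => /msuppM_le/allpairsP[[m1 m2] /= [_ m2x ->]] _.
  apply: leq_trans (leq_trans (leq_addl (digit_sum m1) _) (digit_sumD m1 m2)).
  by apply: (Gr x.2) => //; [apply: Gs; rewrite inE eqxx|rewrite -mcoeff_msupp].
elim: k p m => [//|k IHk] p m; apply: (msupp_span) => _ [a [b [Aa Ab ->]]] {p}m.
rewrite -mcoeff_msupp => /msuppM_le/allpairsP[[m1 m2] /= [m1a m2b ->]].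
apply: leq_trans (digit_sumD m1 m2); rewrite -add1n leq_add //; last first.
  by apply: (IHk b) => //; rewrite -mcoeff_msupp.
rewrite mcoeff_msupp in m1a; apply: (msupp_span _ _ _ _ _ Aa m1a) => _ [i _ <-] m''.
by rewrite mcoeffXn; have [<- _|_] := eqVneq _ m''; rewrite ?digit_sum_Udn ?eqxx.
Qed.

(** A positive digit sum forces some exponent to be at least [d]; splitting off that [x_i^d] lowers
    the digit sum by exactly 1. *)
Lemma power_ideal_expX k m : (k <= digit_sum m)%N ->
  ideal_exp (power_ideal K n d) k 'X_[m].
Proof.
elim: k m => [//|k IHk] m km.
have [i im] : exists i, (d <= m i)%N.
  apply/existsP; apply: contraLR km => /existsPn dm; rewrite -ltnNge ltnS.
  by rewrite /digit_sum big1 // => i _; apply: divn_small; rewrite ltnNge.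
have dm : (U_(i) *+ d <= m)%MM.
  apply/mnm_lepP => j; rewrite mulmnE mnm1E.
  by case: eqP => [<-|_]; rewrite ?mul1n ?mul0n.
exists [:: (1, 'X_[m])]; rewrite big_seq1 mul1r; split=> // u; rewrite inE => /eqP-> /=.
exists ('X_i ^+ d), 'X_[m - U_(i) *+ d]; split.
- exists [:: (1, 'X_i ^+ d)]; rewrite big_seq1 mul1r; split=> // v.
  by rewrite inE => /eqP-> /=; exists i.
- apply: IHk; rewrite /digit_sum (bigD1 i) //=.
  move: km; rewrite /digit_sum (bigD1 i) //=.
  rewrite mnmBE mulmnE mnm1E eqxx mul1n.
  have -> : (\sum_(j | j != i) (m - U_(i) *+ d)%MM j %/ d =
    \sum_(j | j != i) m j %/ d)%N.
    apply: eq_bigr => j ji.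
    by rewrite mnmBE mulmnE mnm1E eq_sym (negPf ji) mul0n subn0.
  by rewrite -{1}(subnK im) divnDr ?dvdnn // divnn d_gt0 addn1 addSn ltnS.
- by rewrite mpolyXn -mpolyXD addmC submK.
Qed.

Lemma power_ideal_expP k p :
  ideal_exp (power_ideal K n d) k p <->
  forall m, p@_m != 0 -> (k <= digit_sum m)%N.
Proof.
split=> [pk m|pk]; first exact: power_ideal_exp_coeff pk.
rewrite [p]mpolyE big_seq; apply: (big_ind (ideal_exp (power_ideal K n d) k)).
- exact: ideal0.
- exact: idealD.
- move=> m mp; rewrite -mul_mpolyC; apply: idealMl; apply: power_ideal_expX.
  by apply: pk; rewrite -mcoeff_msupp.
Qed.

End PowerIdeal.

Section LinearForms.
Variables (K : comNzRingType) (n : nat).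
Implicit Types (m : 'X_{1..n}) (p q L : {mpoly K[n]}).

Lemma linear_formE L : L \is 1.-homog -> L = \sum_i L@_U_(i) *: 'X_i.
Proof.
move=> L1; apply/mpolyP => m; rewrite raddf_sum /=.
have [/eqP/mdeg1P[i /eqP ->]|m1] := eqVneq (mdeg m) 1%N.
  rewrite (bigD1 i) //= mcoeffZ mcoeffXU eqxx mulr1 big1 ?addr0 // => j ji.
  by rewrite mcoeffZ mcoeffXU (negPf ji) mulr0.
rewrite (dhomog_nemf_coeff L1) // big1 // => i _.
rewrite mcoeffZ mcoeffX; case: eqP => [im|]; last by rewrite mulr0.
by move: m1; rewrite -im mdeg1.
Qed.

(** The case [m i = 0] is separate because subtraction of exponents is truncated. *)
Lemma mcoeffXM i p m : ('X_i * p)@_m = if m i == 0%N then 0 else p@_(m - U_(i))%MM.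
Proof.
rewrite mulrC; case: eqP => [mi|/eqP mi]; last first.
  by rewrite -{1}(@submK _ U_(i)%MM m) ?lep1mP // addmC mcoeffMX.
apply/eqP; rewrite mcoeff_eq0 (perm_mem (msuppMX _ _)); apply/mapP => -[m' _ mE].
by move: mi; rewrite mE mnmDE mnm1E eqxx.
Qed.

End LinearForms.

Section Multiplication.
Variables (R : realType) (n d k s : nat) (L : {mpoly R[i][n]}).
Hypotheses (d_gt0 : (0 < d)%N) (L1 : L \is 1.-homog).
Notation pi := (quot_pi (T_ideal R n d k)).

Lemma T_idealP p :
  T_ideal R n d k p <-> forall m, p@_m != 0 -> (k <= digit_sum d m)%N.
Proof. exact: power_ideal_expP. Qed.

(** [u] is the coefficient function of a form [p] of degree [s] that is nonzero modulo the ideal;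
    the last hypothesis says that [L * p] has no monomial outside the ideal. *)
Lemma not_set_inj (u : 'X_{1..n} -> R[i]) :
    (exists m, u m != 0) ->
    (forall m, u m != 0 -> mdeg m = s /\ (digit_sum d m < k)%N) ->
    (forall m, mdeg m = s.+1 -> (digit_sum d m < k)%N ->
      \sum_i L@_U_(i) * (if m i == 0%N then 0 else u (m - U_(i))%MM) = 0) ->
  ~ set_inj (@T_grading R n d k s) ( *%R (pi L)).
Proof.
move=> [m0 u0] us uL injL.
pose p := \sum_(m : 'X_{1..n < s.+1}) u m *: 'X_[m].
have pE m : p@_m = u m.
  have [ms|sm] := leqP (mdeg m) s; first by rewrite mcoeff_mpoly.
  have -> : u m = 0 by apply/eqP; apply: contraTT sm => /us[<-]; rewrite ltnn.
  rewrite /p raddf_sum big1 //= => m' _; rewrite mcoeffZ mcoeffX; case: eqP => [mm|].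
    by have := bmdeg m'; rewrite mm ltnS leqNgt sm.
  by rewrite mulr0.
have ps : p \is s.-homog.
  apply/dhomogP => m; rewrite mcoeff_msupp pE => /us[] //.
have Lp : pi (L * p) = pi 0.
  apply/quot_piP; rewrite subr0; apply/T_idealP => m Lpm.
  rewrite leqNgt; apply: contra_neqN Lpm => mk.
  have [ms|ms] := eqVneq (mdeg m) s.+1; last first.
    by rewrite (dhomog_nemf_coeff (dhomogM L1 ps)) ?add1n.
  rewrite (linear_formE L1) mulr_suml raddf_sum /= -[RHS](uL m ms mk).
  apply: eq_bigr => i _; rewrite -scalerAl mcoeffZ mcoeffXM.
  by case: eqP => // _; rewrite pE.
have : pi p = pi 0.
  apply: injL.
  - by rewrite in_setE; exists p.
  - by rewrite in_setE; exists 0 => //=; apply: dhomog0.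
  - apply: etrans (esym (quot_piM _ L p)) _; rewrite Lp.
    by apply: etrans (quot_piM _ L 0); rewrite mulr0.
move/quot_piP; rewrite subr0 => /T_idealP/(_ m0).
by rewrite pE => /(_ u0); have [_] := us _ u0; rewrite ltnNge => /negP.
Qed.

(** Pairing coefficients with [v] gives a functional [phi] that kills the multiples of [L] and the
    ideal, but not the monomial [m0]; that monomial is therefore missed. *)
Lemma not_set_surj (v : 'X_{1..n} -> R[i]) :
    (exists m, v m != 0) ->
    (forall m, v m != 0 -> mdeg m = s.+1 /\ (digit_sum d m < k)%N) ->
    (forall m, \sum_i L@_U_(i) * v (m + U_(i))%MM = 0) ->
  ~ set_surj (@T_grading R n d k s) (@T_grading R n d k s.+1) ( *%R (pi L)).
Proof.
move=> [m0 v0] vs vL surjL.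
pose phi (p : {mpoly R[i][n]}) := \sum_(m : 'X_{1..n < s.+2}) p@_m * v m.
have phiD p q : phi (p + q) = phi p + phi q.
  by rewrite -big_split; apply: eq_bigr => m _; rewrite mcoeffD mulrDl.
have phiZ a p : phi (a *: p) = a * phi p.
  by rewrite mulr_sumr; apply: eq_bigr => m _; rewrite mcoeffZ mulrA.
have phi_sum (I : Type) (r : seq I) (F : I -> {mpoly R[i][n]}) :
    phi (\sum_(i <- r) F i) = \sum_(i <- r) phi (F i).
  apply: (big_morph phi phiD).
  by rewrite /phi big1 // => m _; rewrite mcoeff0 mul0r.
have phiX m : phi 'X_[m] = v m.
  have [ms|sm] := ltnP (mdeg m) s.+2.
    rewrite /phi (bigD1 (Sub m ms)) //= mcoeffX eqxx mul1r big1 ?addr0 // => m' mm.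
    rewrite mcoeffX; case: eqP => [mE|]; last by rewrite mul0r.
    by move: mm; rewrite -val_eqE /= mE eqxx.
  have -> : v m = 0 by apply/eqP; apply: contraTT sm => /vs[->]; rewrite -ltnNge.
  rewrite /phi big1 // => m' _; rewrite mcoeffX; case: eqP => [mm|].
    by have := bmdeg m'; rewrite -mm ltnNge sm.
  by rewrite mul0r.
have phiL p : phi (L * p) = 0.
  rewrite [p]mpolyE mulr_sumr phi_sum big1 // => m _.
  rewrite -scalerAr phiZ (linear_formE L1) mulr_suml phi_sum.
  rewrite (eq_bigr (fun i => L@_U_(i) * v (m + U_(i))%MM)) ?vL ?mulr0 // => i _.
  by rewrite -scalerAl phiZ -mpolyXD phiX addmC.
have [ms mk] := vs _ v0.
have [|_ [p ps <-] ] := surjL (pi 'X_[m0]).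
  by exists 'X_[m0] => //=; rewrite dhomogX; apply/eqP.
move=> /(etrans (quot_piM _ L p))/quot_piP/T_idealP Lp.
have : phi (L * p - 'X_[m0]) = 0.
  apply: big1 => m _; have [->|/Lp km] := eqVneq ((L * p - 'X_[m0])@_m) 0.
    by rewrite mul0r.
  have [->|/vs[_]] := eqVneq (v m) 0; first by rewrite mulr0.
  by rewrite ltnNge km.
rewrite phiD phiL add0r -scaleN1r phiZ phiX => /eqP.
by rewrite mulN1r oppr_eq0 (negPf v0).
Qed.

End Multiplication.

(** * Three variables *)

Section ThreeVariables.
Variables (x y z : 'I_3).
Hypothesis xyz : uniq [:: x; y; z].

(** [x], [y], [z] is an arbitrary enumeration of the indices, so that a variable with zero
    coefficient in [L] can be named [x]. *)
Lemma big_three (V : Type) (idx : V) (op : Monoid.com_law idx) (F : 'I_3 -> V) :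
  \big[op/idx]_i F i = op (F x) (op (F y) (F z)).
Proof.
have xyzE : index_enum 'I_3 =i [:: x; y; z].
  have [||_ E] := @uniq_min_size _ [:: x; y; z] (index_enum 'I_3) xyz.
  - by move=> i _; apply: mem_index_enum.
  - by rewrite /index_enum; case: index_enum_key; rewrite -enumT size_enum_ord.
  - by move=> i; rewrite E.
rewrite (perm_big [:: x; y; z]) /=; first by rewrite !big_cons big_nil Monoid.mulm1.
by apply: uniq_perm => //; apply: index_enum_uniq.
Qed.

Lemma neq_three : [/\ x == y = false, x == z = false & y == z = false].
Proof.
by move: xyz; rewrite /= !inE negb_or andbT => /andP[/andP[/negPf-> /negPf->] /negPf->].
Qed.

Implicit Type m : 'X_{1..3}.

Definition mnm3 a b c : 'X_{1..3} :=
  [multinom if i == x then a else if i == y then b else c | i < 3].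

Lemma mnm3E a b c :
  [/\ mnm3 a b c x = a, mnm3 a b c y = b & mnm3 a b c z = c].
Proof.
have [xy xz yz] := neq_three.
by rewrite !mnmE !eqxx ![y == x]eq_sym ![z == _]eq_sym xy xz yz.
Qed.

Lemma mdeg3 m : mdeg m = (m x + m y + m z)%N.
Proof. by rewrite mdegE big_three /= addnA. Qed.

Lemma digit_sum3 d m : digit_sum d m = (m x %/ d + m y %/ d + m z %/ d)%N.
Proof. by rewrite /digit_sum big_three /= addnA. Qed.

Lemma sum_three (V : nmodType) (F : 'I_3 -> V) : \sum_i F i = F x + F y + F z.
Proof. by rewrite big_three /= addrA. Qed.

Variables (R : realType) (d k s : nat) (L : {mpoly R[i][3]}).
Hypotheses (d_gt0 : (0 < d)%N) (k_gt0 : (0 < k)%N) (L1 : L \is 1.-homog).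
Let c i := L@_U_(i).
Notation mulL := ( *%R (quot_pi (T_ideal R 3 d k) L)).

Lemma exists_zero : exists al be, c y * al + c z * be = 0 /\ (al != 0) || (be != 0).
Proof.
have [y0|y0] := eqVneq (c y) 0.
  by exists 1, 0; rewrite y0 mul0r mulr0 addr0 oner_eq0.
by exists (- c z), (c y); rewrite y0 orbT; split=> //; ring.
Qed.

(* The kernel element is x^((k-1)d) times the sum of the monomials
   al^(d-1-i) be^(d-1-j) y^i z^j over i, j < d with i + j = d + e. *)
Lemma degenerate_not_inj e : c x = 0 -> s = (k * d + e)%N -> (e.+1 < d)%N ->
  ~ set_inj (@T_grading R 3 d k s) mulL.
Proof.
have [xy xz yz] := neq_three.
move=> cx0 sE ed; have [al [be [zero nz]]] := exists_zero.
have [Q QE] : exists Q, Q = (k.-1 * d)%N by exists (k.-1 * d)%N.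
rewrite -[k in (k * d)%N]prednK // mulSnr -QE in sE.
pose D m := [&& m x == Q, m y < d, m z < d & mdeg m == s]%N.
apply: (@not_set_inj _ _ _ _ _ _ d_gt0 L1 (fun m =>
  if D m then al ^+ (d.-1 - m y) * be ^+ (d.-1 - m z) else 0)).
- case/orP: nz => nz.
    (* At [z^(d-1)] the exponent of [be] is 0, so this coefficient is a power of [al]. *)
    exists (mnm3 Q e.+1 d.-1); rewrite /D mdeg3.
    have [-> -> ->] := mnm3E Q e.+1 d.-1.
    rewrite eqxx subnn expr0 mulr1 ifT ?expf_neq0 //; lia.
  exists (mnm3 Q d.-1 e.+1); rewrite /D mdeg3.
  have [-> -> ->] := mnm3E Q d.-1 e.+1.
  rewrite eqxx subnn expr0 mul1r ifT ?expf_neq0 //; lia.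
- move=> m; case: ifP => [/and4P[/eqP mx my mz /eqP ms] _|]; last by rewrite eqxx.
  by rewrite ms digit_sum3 mx QE mulnK // !divn_small // !addn0; split=> //; lia.
- move=> m ms mk; rewrite sum_three [L@__]cx0 mul0r add0r.
  have [mx|mx] := eqVneq (m x) Q; last first.
    rewrite /D ?(mnmDE, mnmBE, mnm1E) ![y == x]eq_sym ![z == x]eq_sym xy xz.
    by rewrite !subn0 (negPf mx) !if_same !mulr0 addr0.
  move: mk ms; rewrite digit_sum3 mdeg3 mx {1}QE mulnK // => mk ms.
  (* The power of [x] already contributes [k - 1], so the other exponents are below [d]; they add up
     to [d + e + 1], hence both are positive and no boundary term occurs. *)
  have [y0 z0] : (m y %/ d = 0 /\ m z %/ d = 0)%N.
    by move: mk k_gt0; clear; move: (m y %/ d)%N (m z %/ d)%N => p q; lia.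
  have yd : (m y < d)%N by rewrite -[X in (_ < X)%N]mul1n -ltn_divLR // y0.
  have zd : (m z < d)%N by rewrite -[X in (_ < X)%N]mul1n -ltn_divLR // z0.
  have my0 : (0 < m y)%N by lia.
  have mz0 : (0 < m z)%N by lia.
  rewrite (gtn_eqF my0) (gtn_eqF mz0) /D !mdeg3 ?(mnmDE, mnmBE, mnm1E) !eqxx.
  rewrite ![y == x]eq_sym ![z == _]eq_sym xy xz yz !subn0 mx eqxx.
  rewrite !ifT; [|lia|lia].
  have -> : (d.-1 - (m y - 1) = (d.-1 - m y).+1)%N by lia.
  have -> : (d.-1 - (m z - 1) = (d.-1 - m z).+1)%N by lia.
  rewrite !exprS -[RHS](mul0r (al ^+ (d.-1 - m y) * be ^+ (d.-1 - m z))) -zero /c; ring.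
Qed.

(* The functional takes the coefficient of x^(kd-1) and evaluates it at the zero
   (al, be) of L. *)
Lemma degenerate_not_surj e : c x = 0 -> s = (k * d + e)%N -> (e.+2 < d)%N ->
  ~ set_surj (@T_grading R 3 d k s) (@T_grading R 3 d k s.+1) mulL.
Proof.
have [xy xz yz] := neq_three.
move=> cx0 sE ed; have [al [be [zero nz]]] := exists_zero.
have [Q QE] : exists Q, Q = (k.-1 * d)%N by exists (k.-1 * d)%N.
rewrite -[k in (k * d)%N]prednK // mulSnr -QE in sE.
pose D m := (m x == Q + d.-1)%N && (mdeg m == s.+1).
apply: (@not_set_surj _ _ _ _ _ _ d_gt0 L1 (fun m =>
  if D m then al ^+ m y * be ^+ m z else 0)).
- case/orP: nz => nz.
    exists (mnm3 (Q + d.-1) e.+2 0); rewrite /D mdeg3.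
    have [-> -> ->] := mnm3E (Q + d.-1) e.+2 0.
    rewrite eqxx expr0 mulr1 ifT ?expf_neq0 //; lia.
  exists (mnm3 (Q + d.-1) 0 e.+2); rewrite /D mdeg3.
  have [-> -> ->] := mnm3E (Q + d.-1) 0 e.+2.
  rewrite eqxx expr0 mul1r ifT ?expf_neq0 //; lia.
- move=> m; case: ifP => [/andP[/eqP mx /eqP ms] _|]; last by rewrite eqxx.
  rewrite ms digit_sum3 mx; split=> //; move: ms; rewrite mdeg3 mx => ms.
  (* The degree left for [y] and [z] is [e + 2 < d], so only the [x]-exponent [k d - 1] contributes,
     with [k - 1]. *)
  by rewrite QE divnMDl // !divn_small ?addn0; lia.
- move=> m; rewrite sum_three [L@__]cx0 mul0r add0r /D !mdegD !mdeg1.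
  rewrite ?(mnmDE, mnmBE, mnm1E) !eqxx ![y == x]eq_sym ![z == _]eq_sym xy xz yz !addn0.
  case: ifP => _; last by rewrite !mulr0 addr0.
  rewrite !addn1 !exprS -[RHS](mul0r (al ^+ m y * be ^+ m z)) -zero /c; ring.
Qed.

(** * Linear forms with all coefficients nonzero *)

Section Nondegenerate.
Hypothesis c0 : forall i, c i != 0.

(** The effect on monomials of the substitution [x_i -> c_i x_i], which turns the sum of the
    variables into [L]. Kernel elements are scaled by [mon], functionals by its inverse. *)
Let mon m := \prod_i c i ^+ m i.

Let mon_neq0 m : mon m != 0.
Proof. by apply/prodf_neq0 => i _; rewrite expf_neq0. Qed.

Let monDU m i : mon (m + U_(i))%MM = c i * mon m.
Proof.
rewrite /mon (bigD1 i) //= [in RHS](bigD1 i) //= mulrA -exprS.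
rewrite mnmDE mnm1E eqxx addn1.
congr (_ * _); apply: eq_bigr => j ji.
by rewrite mnmDE mnm1E eq_sym (negPf ji) addn0.
Qed.

Lemma symm_not_inj (u : nat -> nat -> nat -> R[i]) :
    (exists a b c, u a b c != 0) ->
    (forall a b c, u a b c != 0 -> outside d k s a b c) ->
    (forall a b c, outside d k s.+1 a b c -> lower u a b c = 0) ->
  ~ set_inj (@T_grading R 3 d k s) mulL.
Proof.
have [xy xz yz] := neq_three.
move=> [a0 [b0 [c0' u0]]] us uL.
apply: (@not_set_inj _ _ _ _ _ _ d_gt0 L1 (fun m => mon m * u (m x) (m y) (m z))).
- exists (mnm3 a0 b0 c0'); have [-> -> ->] := mnm3E a0 b0 c0'.
  by rewrite mulf_neq0.
- move=> m; rewrite mulf_eq0 (negPf (mon_neq0 m)) /= => /us/andP[/eqP <-].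
  by rewrite mdeg3 digit_sum3.
- move=> m ms mk; have := uL (m x) (m y) (m z).
  rewrite /outside -mdeg3 -digit_sum3 ms eqxx mk => /(_ isT) u_m.
  have step i w : c i * (if m i == 0%N then 0 else mon (m - U_(i))%MM * w)
      = mon m * (if m i == 0%N then 0 else w).
    case: eqP => [|/eqP mi]; first by rewrite !mulr0.
    by rewrite mulrA -monDU submK // lep1mP.
  rewrite sum_three !step -!mulrDr ?(mnmDE, mnmBE, mnm1E) !eqxx.
  rewrite ![y == x]eq_sym ![z == _]eq_sym xy xz yz.
  rewrite !subn0 !subn1.
  transitivity (mon m * lower u (m x) (m y) (m z)); last by rewrite u_m mulr0.
  by congr (_ * _); rewrite /lower; case: (m x); case: (m y); case: (m z).
Qed.

Lemma skew_not_surj (v : nat -> nat -> nat -> R[i]) :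
    (exists a b c, v a b c != 0) ->
    (forall a b c, v a b c != 0 -> outside d k s.+1 a b c) ->
    (forall a b c, raise v a b c = 0) ->
  ~ set_surj (@T_grading R 3 d k s) (@T_grading R 3 d k s.+1) mulL.
Proof.
have [xy xz yz] := neq_three.
move=> [a0 [b0 [c0' v0]]] vs vL.
apply: (@not_set_surj _ _ _ _ _ _ d_gt0 L1 (fun m => (mon m)^-1 * v (m x) (m y) (m z))).
- exists (mnm3 a0 b0 c0'); have [-> -> ->] := mnm3E a0 b0 c0'.
  by rewrite mulf_neq0 ?invr_eq0.
- move=> m; rewrite mulf_eq0 invr_eq0 (negPf (mon_neq0 m)) /= => /vs/andP[/eqP <-].
  by rewrite mdeg3 digit_sum3.
- move=> m; have step i w : c i * ((mon (m + U_(i))%MM)^-1 * w) = (mon m)^-1 * w.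
    by rewrite monDU invfM !mulrA divff // mul1r.
  rewrite sum_three !step -!mulrDr ?(mnmDE, mnmBE, mnm1E) !eqxx.
  rewrite ![y == x]eq_sym ![z == _]eq_sym xy xz yz.
  by rewrite !addn0 !addn1 -[_ + _]/(raise v (m x) (m y) (m z)) vL mulr0.
Qed.

End Nondegenerate.

End ThreeVariables.

(** * Numerical criterion and its verification for the three families *)

Lemma not_WLP_three (R : realType) (d k l : nat) (t := (k * d + 2 * l)%N) :
    (0 < l)%N -> (0 < k)%N -> (2 * l + 1 < d)%N ->
    (k * (2 * d) + 4 + 6 * ~~ odd t < k * (k + 3) * (2 * l + 1) + 6 * k./2.+1)%N ->
    (k * (k + 3) * (2 * l + 1) + 4 + 6 * ~~ odd t < k * (2 * d) + 6 * k./2.+1)%N ->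
  ~ weak_Lefschetz (@T_grading R 3 d k).
Proof.
move=> l0 k0 ld h1 h2 [_ [L /= L1 <-] /(_ t.-1)].
have t0 : (0 < t)%N by rewrite /t; lia.
have d0 : (0 < d)%N by lia.
have tE : t.-1 = (k * d + (2 * l).-1)%N by rewrite /t; lia.
pose c i := L@_U_(i).
pose i0 : 'I_3 := inord 0; pose i1 : 'I_3 := inord 1; pose i2 : 'I_3 := inord 2.
have u012 : uniq [:: i0; i1; i2].
  by rewrite /= !inE -!val_eqE /= !inordK.
have [/existsP[x /eqP cx]|/existsPn nz] := boolP [exists x, c x == 0].
  have [y [z xyz]] : exists y z, uniq [:: x; y; z].
    case: x {cx} => [[|[|[|//]]] x3]; [exists i1, i2|exists i0, i2|exists i0, i1];
    by rewrite /= !inE -!val_eqE /= !inordK.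
  case=> [injL|surjL].
    by apply: (degenerate_not_inj xyz d0 k0 L1 cx tE) injL; lia.
  (* With [e = 2 l - 1] the bound [e + 2 < d] is exactly [2 l + 1 < d]. *)
  by apply: (degenerate_not_surj xyz d0 k0 L1 cx tE) surjL; lia.
have tB : (t < k.+1 * d)%N by rewrite /t; lia.
have [lt_symm lt_skew] := orbit_counts l0 (leq_ltn_trans (leq_addr 1 _) ld) h1 h2.
case=> [injL|].
  have [u [u0 us uL]] := exists_symm_lower R[i] tB lt_symm.
  by apply: (symm_not_inj u012 d0 L1 nz u0 us) injL; rewrite prednK.
have [v [v0 vs vL]] := exists_skew_raise R[i] tB lt_skew.
by apply: (skew_not_surj u012 d0 L1 nz v0) vL; rewrite prednK.
Qed.

Local Close Scope ring_scope.
Unset Implicit Arguments.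

Theorem theorem18 (R : realType) (d k j l : nat) :
  (1 <= l)%N ->
  (2 < k)%N ->
  [\/ k = (2 * j + 1)%N /\ d = ((j + 2) * (2 * l + 1))%N,
      [/\ k = (2 * j + 1)%N, k <> 3, k <> 7 &
          d = ((j + 2) * (2 * l + 1) + 1)%N \/
          d = ((j + 2) * (2 * l + 1) - 1)%N]
    | k = (2 * j)%N /\
        (d = ((j + 1) * (2 * l + 1) + l)%N \/
         d = ((j + 1) * (2 * l + 1) + l + 1)%N)] ->
  ~ weak_Lefschetz (@T_grading R 3 d k).
Proof.
(* The difference [2 k d - X] is 0 in case (1), plus or minus [2 k] in case (2), and plus or minus
   [k] in case (3). *)
move=> l1 k2 hd; pose X := (k * (k + 3) * (2 * l + 1))%N.
have p1 : (~~ odd (k * d + 2 * l) <= 1)%N by case: (~~ _).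
have ld : (2 * l + 1 < d)%N by case: hd => [[? ->]|[? _ _ [->|->]]|[? [->|->]]]; nia.
apply: (@not_WLP_three R d k l) => //; first (by lia); rewrite -/X.
- case: hd => [[kE dE]|[kE k3 k7 dE]|[kE dE]].
  + have -> : (k * (2 * d) = X)%N by rewrite /X kE dE; lia.
    have -> : (k./2 = j)%N by lia.
    by clearbody X; lia.
  (* For the worse sign the inequality reads [6 [t even] < 2 j]. It holds for [4 <= j], and for
     [j = 2] since [k], [d] and hence [t] are odd. For [j = 1] and [j = 3], the excluded [k = 3] and
     [k = 7], [t] is even and it fails. *)
  + have kj : (k./2 = j)%N by lia.
    have Xd : (k * (2 * d) <= X + 2 * k)%N by rewrite /X kE; case: dE => ->; lia.
    have pj : (j = 2 \/ 4 <= j)%N by lia.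
    have p2 : (j = 2 -> odd (k * d + 2 * l))%N.
      by move=> j2; case: dE => ->; rewrite kE j2 !(oddD, oddM, oddB) /=; lia.
    rewrite kj; clearbody X; clear -p1 p2 pj Xd kE.
    by case: pj => [/[dup] /p2 -> j2|j4] /=; lia.
  + have -> : (k./2 = j)%N by lia.
    have Xd : (k * (2 * d) <= X + k)%N by rewrite /X kE; case: dE => ->; lia.
    by clearbody X; lia.
- case: hd => [[kE dE]|[kE k3 k7 dE]|[kE dE]].
  + have -> : (k * (2 * d) = X)%N by rewrite /X kE dE; lia.
    have -> : (k./2 = j)%N by lia.
    by clearbody X; lia.
  + have kj : (k./2 = j)%N by lia.
    have Xd : (X <= k * (2 * d) + 2 * k)%N by rewrite /X kE; case: dE => ->; lia.
    have pj : (j = 2 \/ 4 <= j)%N by lia.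
    have p2 : (j = 2 -> odd (k * d + 2 * l))%N.
      by move=> j2; case: dE => ->; rewrite kE j2 !(oddD, oddM, oddB) /=; lia.
    rewrite kj; clearbody X; clear -p1 p2 pj Xd kE.
    by case: pj => [/[dup] /p2 -> j2|j4] /=; lia.
  + have -> : (k./2 = j)%N by lia.
    have Xd : (X <= k * (2 * d) + k)%N by rewrite /X kE; case: dE => ->; lia.
    by clearbody X; lia.
Qed.
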